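(* Let $\alpha>0$ be fixed and let $x_{k+1}=x_k+hY_h(x_k)$ be the discrete system obtained by applying a one-step method of order $p$ with step size $h>0$ to the surrogate system $\dot x=Y(x):=f(x)-\alpha\nabla V(x)$ on $U$. Then for any $\varepsilon\in(0,\nu)$ there exists $h_0>0$ such that for all $0<h<h_0$ the set $U^\varepsilon=V^{-1}([0,\varepsilon])$ is positively invariant under this discrete system, i.e. $\xi\in U^\varepsilon$ implies $\xi+hY_h(\xi)\in U^\varepsilon$.
   Context: Setting. $M$ is a smooth manifold embedded in $\mathbb R^n$, and $\dot x=f(x)$, $x(0)=x_I\in M$, is a dynamical system on $M$ whose solutions on $M$ exist globally and which admits first integrals $f_1,\dots,f_\ell:M\to\mathbb R$. The vector field $f$ and the functions $f_j$ are assumed to extend smoothly to an open neighborhood $U\subset\mathbb R^n$ of $M$ (same symbols for the extensions, so $f:U\to\mathbb R^n$). Put $\Lambda=\{x\in U: x\in M,\ f_j(x)=f_j(x_I),\ j=1,\dots,\ell\}$. $V:U\to\mathbb R_{\ge 0}$ is an analytic function with $V^{-1}(0)=\Lambda$ such that: (A1) $\langle\nabla V(x),f(x)\rangle=0$ for all $x\in U$; (A2) $\nu>0$ is such that $V^{-1}([0,\nu])\subseteq U$ is compact; (A3) all critical points of $V$ in $V^{-1}([0,\nu])$ lie in $V^{-1}(0)$. For $\varepsilon>0$ write $U^\varepsilon:=V^{-1}([0,\varepsilon])$. $|\cdot|$ is the Euclidean norm. One-step method of order $p$ ($p\ge1$ an integer): a family of maps $\xi\mapsto \xi+hY_h(\xi)$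 such that, for every compact $K\subset U$, there are $h_{\mathrm{loc}},C>0$ such that for all $\xi\in K$ and $h\in(0,h_{\mathrm{loc}}]$ the map is defined at $\xi$ and $|\xi+hY_h(\xi)-x(h;\xi)|\le C h^{p+1}$, where $x(\cdot;\xi)$ is the solution of $\dot x=Y(x)$ with $x(0)=\xi$. *)

(* Defs.v *)
From HB Require Import structures.
From mathcomp Require Import all_boot all_order all_algebra.
From mathcomp Require Import all_classical all_reals all_analysis.
Import Order.TTheory GRing.Theory Num.Theory.
Import numFieldNormedType.Exports.

Set Implicit Arguments.
Unset Strict Implicit.
Unset Printing Implicit Defensive.

Local Open Scope classical_set_scope.
Local Open Scope ring_scope.

(* The library norm of 'rV[R]_n is the sup norm; it is equivalent to the
   Euclidean one and only enters through the topology and differentiability. *)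
Definition dotp (R : realType) (n : nat) (u v : 'rV[R]_n) : R :=
  \sum_(i < n) u 0 i * v 0 i.

Definition enorm (R : realType) (n : nat) (u : 'rV[R]_n) : R :=
  Num.sqrt (dotp u u).

Definition grad (R : realType) (n : nat) (V : 'rV[R]_n -> R) (x : 'rV[R]_n) :
    'rV[R]_n :=
  \row_(i < n) 'D_(delta_mx 0 i) V x.

(* C^k on an open set U; only the values of g on U matter. *)
Fixpoint Ck_on (R : realType) (E F : normedModType R) (k : nat) (U : set E)
    (g : E -> F) : Prop :=
  if k is k'.+1 then
    (forall x, U x -> differentiable g x) /\
    (forall v, Ck_on k' U (fun x => 'D_v g x))
  else forall x, U x -> {for x, continuous g}.

Definition smooth_on (R : realType) (E F : normedModType R) (U : set E)
    (g : E -> F) : Prop :=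
  forall k, Ck_on k U g.

Definition monomial (R : realType) (n : nat) (m : {ffun 'I_n -> nat})
    (x : 'rV[R]_n) : R :=
  \prod_(i < n) x 0 i ^+ m i.

(* V is the sum of an absolutely convergent power series in x - a on a
   neighbourhood of each point a of U.  By absolute convergence the order of
   summation is immaterial; the partial sums are taken over the boxes of
   multi-indices with all entries < N. *)
Definition analytic_on (R : realType) (n : nat) (U : set 'rV[R]_n)
    (V : 'rV[R]_n -> R) : Prop :=
  forall a, U a -> exists c : {ffun 'I_n -> nat} -> R,
    \forall x \near a,
      summable [set: {ffun 'I_n -> nat}]
        (fun m => (c m * monomial m (x - a))%:E) /\
      (fun N => \sum_(b : {ffun 'I_n -> 'I_N})
                  let m : {ffun 'I_n -> nat} := [ffun i => nat_of_ord (b i)] in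
                  c m * monomial m (x - a))
        @ \oo --> V x.

(* Slice charts: near each of its points, M is mapped by a smooth
   diffeomorphism phi : W -> W' of open sets, with inverse psi, onto
   W' cap (R^k x {0}). *)
Definition embedded_submanifold (R : realType) (n k : nat)
    (M : set 'rV[R]_n) : Prop :=
  (k <= n)%N /\
  forall x, M x ->
    exists (W W' : set 'rV[R]_n) (phi psi : 'rV[R]_n -> 'rV[R]_n),
      [/\ open W /\ W x, open W',
          smooth_on W phi /\ smooth_on W' psi,
          (forall y, W y -> W' (phi y) /\ psi (phi y) = y) /\
          (forall z, W' z -> W (psi z) /\ phi (psi z) = z) &
          forall y, W y ->
            (M y <-> forall i : 'I_n, (k <= i)%N -> phi y 0 i = 0)].

Definition tangent_to (R : realType) (n : nat) (M : set 'rV[R]_n)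
    (x v : 'rV[R]_n) : Prop :=
  exists (d : R) (gamma : R -> 'rV[R]_n),
    [/\ 0 < d, smooth_on (ball (0 : R) d) gamma,
        forall t, ball (0 : R) d t -> M (gamma t),
        gamma 0 = x & is_derive (0 : R) (1 : R) gamma v].

(* x solves x' = F(x) on the interval I with values in D.  At an endpoint
   belonging to I only continuity is required; the one-sided derivative is
   then F(x) as well when F is continuous on D. *)
Definition solution_on (R : realType) (n : nat) (F : 'rV[R]_n -> 'rV[R]_n)
    (D : set 'rV[R]_n) (I : interval R) (x : R -> 'rV[R]_n) : Prop :=
  [/\ {within [set` I], continuous x},
      forall t, [set` I] t -> D (x t) &
      forall t, [set` I]° t -> is_derive t (1 : R) x (F (x t))].

(* Globally in forward time. *)
Definition global_solutions_on (R : realType) (n : nat)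
    (f : 'rV[R]_n -> 'rV[R]_n) (M : set 'rV[R]_n) : Prop :=
  forall xi, M xi ->
    exists x, solution_on f M `[0, +oo[ x /\ x 0 = xi.

Definition first_integral_on (R : realType) (n : nat)
    (f : 'rV[R]_n -> 'rV[R]_n) (M : set 'rV[R]_n) (g : 'rV[R]_n -> R) : Prop :=
  forall (T : R) x, solution_on f M `[0, T] x ->
    forall t, `[0, T]%classic t -> g (x t) = g (x 0).

(* V^-1([0, e]) for V viewed as a function on U *)
Definition sublevel (R : realType) (n : nat) (U : set 'rV[R]_n)
    (V : 'rV[R]_n -> R) (e : R) : set 'rV[R]_n :=
  U `&` V @^-1` `[0, e].

(* A family of partial maps xi |-> xi + h *: Yh h xi, the h-th one being
   defined on dom h. *)
Definition step (R : realType) (n : nat) (Yh : R -> 'rV[R]_n -> 'rV[R]_n)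
    (h : R) (xi : 'rV[R]_n) : 'rV[R]_n :=
  xi + h *: Yh h xi.

(* The solution x(.; xi) is unique for locally Lipschitz Y; that x(h; xi) makes
   sense, i.e. that the solution exists up to time hloc, is part of the
   condition. *)
Definition one_step_method (R : realType) (n p : nat) (U : set 'rV[R]_n)
    (Y : 'rV[R]_n -> 'rV[R]_n) (dom : R -> set 'rV[R]_n)
    (Yh : R -> 'rV[R]_n -> 'rV[R]_n) : Prop :=
  forall K : set 'rV[R]_n, compact K -> K `<=` U ->
    exists hloc C : R, [/\ 0 < hloc, 0 < C &
      forall xi, K xi ->
        exists x : R -> 'rV[R]_n,
          [/\ solution_on Y U `[0, hloc] x, x 0 = xi &
              forall h, 0 < h <= hloc ->
                dom h xi /\ enorm (step Yh h xi - x h) <= C * h ^+ p.+1]].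

Definition positively_invariant (R : realType) (n : nat)
    (dom : set 'rV[R]_n) (Phi : 'rV[R]_n -> 'rV[R]_n) (A : set 'rV[R]_n) :
    Prop :=
  forall xi, A xi -> dom xi /\ A (Phi xi).

(* Main.v *)
Require Import Defs.
From HB Require Import structures.
From mathcomp Require Import all_boot all_order all_algebra.
From mathcomp Require Import all_classical all_reals all_analysis.
From mathcomp Require Import ring lra.
Import Order.TTheory GRing.Theory Num.Theory.
Import numFieldNormedType.Exports.

(* Along an exact solution V decreases at rate alpha |grad V|^2.  On the compact
   set where eps/2 <= V <= nu this rate is at least some alpha m > 0, so an exact
   step of length h ends where V <= max (eps/2, eps - alpha m h).  Since p >= 1,
   the method then moves V by at most L C h^2 more, L being a Lipschitz constant
   of V near that compact set, and for small h this is less than eps/2 and than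
   alpha m h.  Analyticity only serves to make V of class C^1: a power series at
   a is strictly differentiable at a, with remainder O(s |x - y|) on the ball of
   radius s, which gives at once differentiability at a, continuity of the
   gradient at a and a Lipschitz bound near a. *)

Set Implicit Arguments.
Unset Strict Implicit.
Unset Printing Implicit Defensive.

Local Open Scope classical_set_scope.
Local Open Scope ring_scope.

(** * Lipschitz estimates for monomials near the origin *)

Lemma coord_le_norm (R : realType) (n : nat) (x : 'rV[R]_n) i : `|x 0 i| <= `|x|.
Proof.
by rewrite [leRHS]/Num.norm /= mx_normrE; apply/bigmax_geP; right => /=; exists (0, i).
Qed.

(* Multiplying the difference by [s] replaces the exponent [p - 1] by [p]. *)
Definition close_monomials (R : realType) (s d : R) (p : nat) (P Q : R) :=
  [/\ `|P| <= s ^+ p, `|Q| <= s ^+ p & s * `|P - Q| <= p%:R * s ^+ p * d].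

Lemma close_monomials0 (R : realType) (s d : R) : close_monomials s d 0 1 1.
Proof. by split; rewrite ?normr1 ?expr0// subrr normr0 mulr0 !mul0r. Qed.

(** The splitting [P * Q - P' * Q' = P * (Q - Q') + (P - P') * Q'] makes the degrees add, and with
    them the factors [p%:R] and [q%:R]. *)
Lemma close_monomialsM (R : realType) (s d : R) p q P P' Q Q' :
  0 <= s -> 0 <= d ->
  close_monomials s d p P P' -> close_monomials s d q Q Q' ->
  close_monomials s d (p + q)%N (P * Q) (P' * Q').
Proof.
move=> s0 d0 [Pp P'p PP'] [Qq Q'q QQ']; split.
- by rewrite normrM exprD ler_pM.
- by rewrite normrM exprD ler_pM.
have -> : P * Q - P' * Q' = P * (Q - Q') + (P - P') * Q' by ring.
apply: (@le_trans _ _ (`|P| * (s * `|Q - Q'|) + s * `|P - P'| * `|Q'|)).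
  apply: le_trans (ler_wpM2l s0 (ler_normD _ _)) _.
  by rewrite !normrM mulrDr mulrA (mulrC s `|P|) !mulrA.
have -> : (p + q)%:R * s ^+ (p + q) * d =
    s ^+ p * (q%:R * s ^+ q * d) + p%:R * s ^+ p * d * s ^+ q.
  by rewrite natrD exprD; ring.
by apply: lerD; apply: ler_pM => //; rewrite mulr_ge0.
Qed.

Lemma close_monomials_monomial (R : realType) (n : nat) (s d : R)
    (x y : 'rV[R]_n) (m : {ffun 'I_n -> nat}) :
  `|x| <= s -> `|y| <= s -> `|x - y| <= d ->
  close_monomials s d (\sum_i m i)%N (monomial m x) (monomial m y).
Proof.
move=> xs ys xyd.
have s0 : 0 <= s by exact: le_trans xs.
have d0 : 0 <= d by exact: le_trans xyd.
rewrite /monomial.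
(* The induction runs at once over the degree and the two products, coordinate by coordinate. *)
apply: (big_ind3 (fun p P Q => close_monomials s d p P Q)).
- exact: close_monomials0.
- by move=> *; exact: close_monomialsM.
move=> i _; elim: (m i) => [|k IH]; first exact: close_monomials0.
rewrite !exprS -add1n; apply: close_monomialsM => //; split.
- by rewrite expr1 (le_trans (coord_le_norm _ _)).
- by rewrite expr1 (le_trans (coord_le_norm _ _)).
have -> : x 0 i - y 0 i = (x - y) 0 i by rewrite !mxE.
by rewrite mul1r expr1 ler_wpM2l// (le_trans (coord_le_norm _ _)).
Qed.

(* The factor [2^-|m|] gained from [s <= rho / 2] absorbs the degree [|m|]. *)
Lemma monomial_lipschitz (R : realType) (n : nat) (s rho : R)
    (x y : 'rV[R]_n) (m : {ffun 'I_n -> nat}) :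
  0 < rho -> s <= rho / 2 -> `|x| <= s -> `|y| <= s -> (2 <= \sum_i m i)%N ->
  `|monomial m x - monomial m y| <=
    rho ^+ (\sum_i m i)%N * (4 / rho ^+ 2 * s * `|x - y|).
Proof.
move=> rho0 srho xs ys m2.
have s0 : 0 <= s by exact: le_trans xs.
have := close_monomials_monomial m xs ys (lexx _).
move: m2; case: (\sum_i m i)%N => [//|[//|e _]] [Px Py Pxy].
have -> : rho ^+ e.+2 * (4 / rho ^+ 2 * s * `|x - y|) = 4 * rho ^+ e * s * `|x - y|.
  by rewrite !exprS expr0; field; rewrite gt_eqF.
(* The available bound is on [s * |P - Q|], so [s] must be cancelled. For [s = 0] both monomials
   vanish because their degree is positive. *)
have [s_eq0|s_neq0] := eqVneq s 0.
  move: Px Py; rewrite s_eq0 exprS mul0r !normr_le0 => /eqP -> /eqP ->.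
  by rewrite subrr normr0 mulr0 mul0r.
have s_gt0 : 0 < s by rewrite lt_neqAle eq_sym s_neq0.
rewrite -(ler_pM2l s_gt0); apply: le_trans Pxy _.
have -> : s * (4 * rho ^+ e * s * `|x - y|) = 4 * rho ^+ e * (s ^+ 2 * `|x - y|).
  by ring.
have -> : e.+2%:R * s ^+ e.+2 * `|x - y| = e.+2%:R * s ^+ e * (s ^+ 2 * `|x - y|).
  by rewrite !exprS expr0; ring.
rewrite ler_wpM2r ?mulr_ge0 ?sqr_ge0//.
have -> : 4 * rho ^+ e = 2 ^+ e.+2 * (rho / 2) ^+ e :> R.
  by rewrite expr_div_n !exprS; field; rewrite expf_neq0.
apply: ler_pM; rewrite ?ler0n ?exprn_ge0//.
  by rewrite -natrX ler_nat ltnW// ltn_expl.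
by rewrite lerXn2r// nnegrE ?divr_ge0// ltW.
Qed.

(** * Strict differentiability of a power series at its centre *)

Lemma sum_inj_le_esum (R : realType) (T : finType) (T' : choiceType) (e : T -> T')
    (a : T' -> \bar R) :
  injective e -> (forall j, (0 <= a j)%E) ->
  (\sum_(t : T) a (e t) <= \esum_(j in [set: T']) a j)%E.
Proof.
move=> einj a0; apply: esum_ge; exists [set` map e (enum T)].
  by split => //; exact: finite_seq.
rewrite -(@bigfs _ _ _ _ (map e (enum T)) (mem (map e (enum T)))).
- by rewrite -big_seq big_map big_enum.
- by rewrite map_inj_uniq ?enum_uniq.
- by move=> i + /negP.
Qed.

Definition box_index (n N : nat) (b : {ffun 'I_n -> 'I_N}) : {ffun 'I_n -> nat} :=
  [ffun i => nat_of_ord (b i)].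

Lemma box_index_inj n N : injective (@box_index n N).
Proof.
move=> b b' /ffunP bb'; apply/ffunP => i; apply/val_inj.
by have := bb' i; rewrite !ffunE.
Qed.

Definition unit_index (n : nat) (i : 'I_n) : {ffun 'I_n -> nat} :=
  [ffun j => (j == i) : nat].

Lemma monomial_unit_index (R : realType) n (i : 'I_n) (x : 'rV[R]_n) :
  monomial (unit_index i) x = x 0 i.
Proof.
rewrite /monomial (bigD1 i)//= ffunE eqxx expr1 big1 ?mulr1// => j ji.
by rewrite ffunE (negbTE ji).
Qed.

(** A multi-index of degree 1 has a single entry 1 and zeros elsewhere. The side [N.+2] makes room
    for the entry 1. *)
Lemma sum_box_degree1 (R : realType) n N (F : {ffun 'I_n -> nat} -> R) :
  \sum_(b : {ffun 'I_n -> 'I_N.+2} | (\sum_i b i == 1)%N) F (box_index b) =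
  \sum_(i < n) F (unit_index i).
Proof.
pose h (i : 'I_n) : {ffun 'I_n -> 'I_N.+2} := [ffun j => inord (j == i)].
have hE i : box_index (h i) = unit_index i.
  apply/ffunP => j; rewrite !ffunE inordK//.
  by case: (j == i).
have hinj : injective h.
  move=> i j /(congr1 (@box_index n N.+2)); rewrite !hE => /ffunP/(_ i).
  by rewrite !ffunE eqxx; case: eqVneq.
transitivity (\sum_(b in (h @: 'I_n)%SET) F (box_index b)); last first.
  by rewrite big_imset//=; [apply: eq_bigr => i _; rewrite hE|exact: in2W].
apply: eq_bigl => b; apply/sum_nat_eq1/imsetP => [[i [_ bi1 bi0]]|[i _ ->]].
  exists i => //; apply: (@box_index_inj n N.+2); rewrite hE; apply/ffunP => j.
  by rewrite !ffunE; have [->|/bi0->] := eqVneq j i.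
have hiE j : h i j = (j == i) :> nat.
  by have /ffunP/(_ j) := hE i; rewrite !ffunE.
by exists i; split=> //= [|j ji _]; rewrite hiE ?eqxx ?(negbTE ji).
Qed.

(** Terms of degree 0 cancel in the difference and those of degree 1 form the linear part. Each
    remaining term obeys [monomial_lipschitz], and the weights [|c m| * rho ^ |m|] sum to at most
    [S], a bound free of [N]. *)
Lemma box_sum_strictly_differentiable (R : realType) n N
    (c : {ffun 'I_n -> nat} -> R) (rho s S : R) (x y : 'rV[R]_n) :
  0 < rho -> s <= rho / 2 -> `|x| <= s -> `|y| <= s ->
  \sum_(b : {ffun 'I_n -> 'I_N.+2})
    `|c (box_index b) * rho ^+ (\sum_i box_index b i)| <= S ->
  `|\sum_(b : {ffun 'I_n -> 'I_N.+2}) c (box_index b) * monomial (box_index b) x -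
    \sum_(b : {ffun 'I_n -> 'I_N.+2}) c (box_index b) * monomial (box_index b) y -
    dotp (\row_i c (unit_index i)) (x - y)| <= S * (4 / rho ^+ 2 * s * `|x - y|).
Proof.
move=> rho0 srho xs ys leS.
have s0 : 0 <= s by exact: le_trans xs.
pose T m := c m * (monomial m x - monomial m y).
rewrite -sumrB (eq_bigr (fun b => T (box_index b))); last first.
  by move=> b _; rewrite /T mulrBr.
have -> : dotp (\row_i c (unit_index i)) (x - y) = \sum_i T (unit_index i).
  by apply: eq_bigr => i _; rewrite /T !monomial_unit_index !mxE.
pose deg1 (b : {ffun 'I_n -> 'I_N.+2}) := (\sum_i b i == 1)%N.
rewrite -(sum_box_degree1 N T) (bigID deg1)/=.
rewrite addrAC subrr add0r.
apply: le_trans (ler_norm_sum _ _ _) _.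
apply: le_trans (ler_wpM2r _ leS); last first.
  by rewrite !mulr_ge0// invr_ge0 sqr_ge0.
rewrite [in leRHS](bigID deg1)/= mulrDl.
rewrite -[leLHS]add0r lerD//.
  apply: mulr_ge0; first by apply: sumr_ge0 => b _; exact: normr_ge0.
  by rewrite !mulr_ge0// invr_ge0 sqr_ge0.
rewrite mulr_suml; apply: ler_sum => b b1.
rewrite !normrM -mulrA ler_wpM2l// (ger0_norm (exprn_ge0 _ (ltW rho0))).
have sumE : (\sum_i box_index b i = \sum_i b i)%N.
  by apply: eq_bigr => i _; rewrite ffunE.
case: (ltnP (\sum_i box_index b i) 2) => [b2|]; last exact: monomial_lipschitz.
have /eqP : (\sum_i box_index b i = 0)%N.
  by move: b1 b2; rewrite sumE /deg1; case: (\sum_i b i)%N => [|[]].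
rewrite sum_nat_eq0 => /forallP b0.
have mono1 z : monomial (box_index b) z = 1 :> R.
  by rewrite /monomial big1// => i _; have /eqP -> := b0 i; rewrite expr0.
rewrite !mono1 subrr normr0 !mulr_ge0 ?exprn_ge0// ?invr_ge0 ?sqr_ge0//.
exact: ltW.
Qed.

(** Stronger than the usual notion, whose remainder is only [o(|x - y|)]: a single [C] gives a rate
    linear in the radius [s]. *)
Definition strictly_differentiable (R : realType) n (V : 'rV[R]_n -> R)
    (a l : 'rV[R]_n) :=
  exists C r : R, [/\ 0 <= C, 0 < r &
    forall (s : R) x y, s <= r -> `|x - a| <= s -> `|y - a| <= s ->
      `|V x - V y - dotp l (x - y)| <= C * s * `|x - y|].

Lemma analytic_strictly_differentiable (R : realType) n (U : set 'rV[R]_n)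
    (V : 'rV[R]_n -> R) a :
  analytic_on U V -> U a -> exists l, strictly_differentiable V a l.
Proof.
move=> anV Ua; have [c /nbhs_ballP[r /= r0 Vc]] := anV _ Ua.
exists (\row_i c (unit_index i)).
pose rho := r / 2; have rho0 : 0 < rho by rewrite divr_gt0.
have cvgV x : `|x - a| <= rho ->
    (fun N => \sum_(b : {ffun 'I_n -> 'I_N})
      c (box_index b) * monomial (box_index b) (x - a)) @ \oo --> V x.
  move=> xa; apply: (Vc x _).2.
  by rewrite -ball_normE/= distrC (le_lt_trans xa)// /rho; lra.
(* A corner of the sup-norm ball of radius [rho]: every monomial takes the value [rho ^ |m|] at
   [xr - a], so absolute convergence at [xr] bounds the sum of all [|c m| * rho ^ |m|]. *)
pose xr : 'rV[R]_n := a + const_mx rho.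
have xra : ball a r xr.
  rewrite -ball_normE/= opprD addNKr normrN (@le_lt_trans _ _ rho)//; last first.
    by rewrite /rho; lra.
  rewrite /Num.norm/= mx_normrE; apply/bigmax_leP; split; first exact: ltW.
  by move=> i _; rewrite mxE gtr0_norm.
have [sumc _] := Vc _ xra.
pose S := fine (\esum_(m in [set: {ffun 'I_n -> nat}])
                 `|(c m * monomial m (xr - a))%:E|)%E.
have monoE m : monomial m (xr - a) = rho ^+ (\sum_i m i)%N.
  rewrite /xr addrAC subrr add0r /monomial expr_sum.
  by apply: eq_bigr => i _; rewrite mxE.
have SE N : \sum_(b : {ffun 'I_n -> 'I_N})
    `|c (box_index b) * rho ^+ (\sum_i box_index b i)| <= S.
  have finS := sumc; rewrite summableE in finS.
  rewrite -lee_fin /S fineK// -sumEFin.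
  have := @sum_inj_le_esum R _ _ (@box_index n N)
    (fun m => `|(c m * monomial m (xr - a))%:E|%E) (@box_index_inj n N).
  move=> /(_ (fun=> abse_ge0 _)); apply: le_trans.
  by apply: lee_sum => b _; rewrite monoE.
have S0 : 0 <= S by rewrite /S fine_ge0// esum_ge0.
exists (S * (4 / rho ^+ 2)), (rho / 2); split.
- by rewrite !mulr_ge0// invr_ge0 sqr_ge0.
- by rewrite divr_gt0.
move=> s x y srho xs ys.
have srho' : s <= rho by apply: le_trans srho _; lra.
pose B x N := \sum_(b : {ffun 'I_n -> 'I_N})
  c (box_index b) * monomial (box_index b) (x - a).
have cvgW : (fun N => B x N - B y N - dotp (\row_i c (unit_index i)) (x - y))
    @ \oo --> V x - V y - dotp (\row_i c (unit_index i)) (x - y).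
  apply: cvgB; last exact: cvg_cst.
  by apply: cvgB; apply: cvgV; [exact: le_trans srho'|exact: le_trans ys srho'].
(* The estimate is uniform in the box size, hence passes to the limit. Boxes of side 0 and 1 are
   skipped, as they miss the linear terms. *)
apply: (cvgr_to_le (cvg_norm cvgW)).
exists 2%N => // -[|[|N]]// _.
have -> : x - y = (x - a) - (y - a) by rewrite opprB addrA subrK.
by rewrite -!(mulrA S); exact: box_sum_strictly_differentiable.
Qed.

(** * Derivative, continuity of the gradient and Lipschitz bounds from strict differentiability *)

Lemma dotp_is_linear (R : realType) n (l : 'rV[R]_n) :
  linear (dotp l : 'rV[R]_n -> R^o).
Proof.
move=> k u v; rewrite /dotp scaler_sumr -big_split/=; apply: eq_bigr => i _.
by rewrite !mxE mulrDr mulrCA.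
Qed.

HB.instance Definition _ (R : realType) n (l : 'rV[R]_n) :=
  @GRing.isLinear.Build R 'rV[R]_n R^o *:%R (dotp l) (dotp_is_linear l).

Lemma dotp_le_norm (R : realType) n (l u : 'rV[R]_n) :
  `|dotp l u| <= (\sum_i `|l 0 i|) * `|u|.
Proof.
rewrite mulr_suml; apply: le_trans (ler_norm_sum _ _ _) _; apply: ler_sum => i _.
by rewrite normrM ler_wpM2l// coord_le_norm.
Qed.

Lemma dotp_delta_mx (R : realType) n (l : 'rV[R]_n) i :
  dotp l (delta_mx 0 i) = l 0 i.
Proof.
rewrite /dotp (bigD1 i)//= mxE !eqxx mulr1 big1 ?addr0// => j ji.
by rewrite mxE (negbTE ji) andbF mulr0.
Qed.

Lemma dotp_continuous (R : realType) n (l : 'rV[R]_n) : continuous (dotp l).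
Proof.
apply: (@bounded_linear_continuous R _ R^o (dotp l)); apply/linear_boundedP.
near=> r => x; apply: le_trans (dotp_le_norm _ _) _; rewrite ler_wpM2r//.
Unshelve. all: end_near. Qed.

(** With one point at [a] and [s] the length of the displacement, the remainder is quadratic in the
    displacement. *)
Lemma strictly_differentiable_is_diff (R : realType) n (V : 'rV[R]_n -> R)
    (a l : 'rV[R]_n) :
  strictly_differentiable V a l -> is_diff a V (dotp l).
Proof.
move=> [C [r [C0 r0 Vl]]].
have Vo : (V \o shift a : 'rV[R]_n -> R^o) = cst (V a) + dotp l +o_ (0 : 'rV[R]_n) id.
  apply/eqaddoP => e e0; near=> x.
  have xa : `|x + a - a| <= `|x| by rewrite addrK.
  have aa : `|a - a| <= `|x| by rewrite subrr normr0.
  have xr : `|x| <= r.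
    by near: x; apply: cvgr_norm_le; [exact: cvg_id|rewrite normr0].
  have := Vl _ _ _ xr xa aa; rewrite addrK /=.
  rewrite [X in _ -> `|X| <= _](_ : _ = V (x + a) - V a - dotp l x); last first.
    by rewrite !fctE/= opprD addrA.
  move/le_trans; apply; rewrite ler_wpM2r//.
  have Cx : C * `|x| <= (C + 1) * `|x| by rewrite ler_wpM2r// lerDl.
  apply: le_trans Cx _; rewrite mulrC -ler_pdivlMr ?ltr_wpDl//.
  near: x; apply: cvgr_norm_le; [exact: cvg_id|rewrite normr0].
  by rewrite divr_gt0// ltr_wpDl.
have dV := diff_unique (@dotp_continuous R n l) Vo.
split => //; apply/diff_locallyP; rewrite dV; split => //.
exact: dotp_continuous.
Unshelve. all: end_near. Qed.

Lemma strictly_differentiable_grad (R : realType) n (V : 'rV[R]_n -> R)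
    (a l : 'rV[R]_n) :
  strictly_differentiable V a l -> l = grad V a.
Proof.
move=> /strictly_differentiable_is_diff dV; apply/rowP => i.
by rewrite mxE deriveE// diff_val dotp_delta_mx.
Qed.

(** For [b] near [a], both [b] and [b + h e_i] lie in the ball of radius [s] about [a], so the
    difference quotient at [b] is within [C * s] of the partial derivative at [a]. Letting [h] tend
    to 0 keeps this bound. *)
Lemma grad_continuous (R : realType) n (V : 'rV[R]_n -> R) (a : 'rV[R]_n) i :
  (\forall b \near a, differentiable V b) ->
  strictly_differentiable V a (grad V a) ->
  {for a, continuous (fun x => grad V x 0 i)}.
Proof.
move=> diffV [C [r [C0 r0 Vl]]]; apply/(@cvgrPdist_le _ _ _ (nbhs a)) => e e0.
(* Chosen so that [C * s <= e]; the [+ 1] covers [C = 0]. *)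
pose s := Num.min r (e / (C + 1)).
have s0 : 0 < s by rewrite lt_min r0 divr_gt0// ltr_wpDl.
have Cs : C * s <= e.
  apply: (@le_trans _ _ ((C + 1) * s)); first by rewrite ler_wpM2r ?lerDl// ltW.
  by rewrite mulrC -ler_pdivlMr ?ltr_wpDl// ge_min lexx orbT.
near=> b.
have bs : `|b - a| < s.
  have : ball a s b by near: b; exact: nbhsx_ballx.
  by rewrite -ball_normE/= distrC.
have /(_ (delta_mx 0 i)) : forall v, derivable V b v.
  by move=> v; apply: diff_derivable; near: b.
move=> /cvg_ex[d dV]; have {1}-> : grad V b = \row_j 'D_(delta_mx 0 j) V b by [].
rewrite distrC mxE (cvg_lim _ dV : 'D_(delta_mx 0 i) V b = d)//.
pose u : 'rV[R]_n := delta_mx 0 i.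
have {}dV : (fun h => `|h^-1 * (V (h *: u + b) - V b) - grad V a 0 i|) @ 0^'
    --> `|d - grad V a 0 i|.
  by apply: cvg_norm; apply: cvgB; [exact: dV|exact: cvg_cst].
apply: (cvgr_to_le dV); near=> h.
have h0 : h != 0 by near: h; exact: nbhs_dnbhs_neq.
(* Since [b] is strictly inside the ball of radius [s], small [h] keep the shifted point in it. *)
have hb : `|h *: u + b - a| <= s.
  have hs : `|h| <= (s - `|b - a|) / (`|u| + 1).
    by near: h; apply: dnbhs0_le; rewrite divr_gt0 ?subr_gt0// ltr_wpDl.
  rewrite -addrA; apply: le_trans (ler_normD _ _) _.
  rewrite -lerBrDr normrZ; move: hs; rewrite ler_pdivlMr ?ltr_wpDl//.
  by apply: le_trans; rewrite ler_wpM2l// lerDl.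
have sr : s <= r by rewrite ge_min lexx.
have := Vl _ _ _ sr hb (ltW bs); rewrite addrK linearZ/= dotp_delta_mx => Vh.
have -> : h^-1 * (V (h *: u + b) - V b) - grad V a 0 i =
    h^-1 * (V (h *: u + b) - V b - h *: grad V a 0 i).
  by rewrite [h *: grad V a 0 i]/(h * grad V a 0 i) [RHS]mulrBr mulKf.
rewrite normrM normfV ler_pdivrMl ?normr_gt0//; apply: le_trans Vh _.
rewrite mulrC; apply: (@le_trans _ _ (`|h| * (C * s))); last by rewrite ler_wpM2l.
rewrite ler_wpM2r ?(mulr_ge0 C0 (ltW s0))// normrZ ger_pMr ?normr_gt0//.
rewrite /Num.norm/= mx_normrE; apply/bigmax_leP; split=> // -[j k] _ /=.
by rewrite mxE; case: (_ && _); rewrite ?normr1 ?normr0.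
Unshelve. all: end_near. Qed.

(** One large parameter [L] serves as Lipschitz constant and as inverse radius, a form suited to the
    compactness argument by near coverings. *)
Lemma strictly_differentiable_lipschitz (R : realType) n (V : 'rV[R]_n -> R)
    (a l : 'rV[R]_n) :
  strictly_differentiable V a l ->
  \forall x \near a & L \near +oo,
    forall y, `|y - x| < L^-1 -> `|V y - V x| <= L * `|y - x|.
Proof.
move=> [C [r [C0 r0 Vl]]]; near=> x L => /= y yx.
have L0 : 0 < L by near: L; exact: nbhs_pinfty_gt.
have xa : `|x - a| <= r / 2.
  have : ball a (r / 2) x by near: x; apply: nbhsx_ballx; rewrite divr_gt0.
  by rewrite -ball_normE/= distrC => /ltW.
have Lr : L^-1 <= r / 2 by rewrite invf_ple ?posrE ?divr_gt0.
have ya : `|y - a| <= r.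
  rewrite -(subrK x y) -addrA; apply: le_trans (ler_normD _ _) _.
  by rewrite [leRHS]splitr lerD// (le_trans (ltW yx)).
have xa' : `|x - a| <= r by apply: le_trans xa _; lra.
have Vyx := Vl _ _ _ (lexx r) ya xa'.
(* Adding and subtracting the linear part shows that [L] only has to exceed [C * r] plus the sum of
   the [|l 0 i|]. *)
rewrite -(subrK (dotp l (y - x)) (V y - V x)).
apply: le_trans (ler_normD _ _) _.
apply: le_trans (lerD Vyx (dotp_le_norm _ _)) _.
rewrite -mulrDl ler_wpM2r//.
Unshelve. all: end_near. Qed.

Lemma strictly_differentiable_continuous (R : realType) n (V : 'rV[R]_n -> R)
    (a l : 'rV[R]_n) :
  strictly_differentiable V a l -> {for a, continuous V}.
Proof.
move=> /strictly_differentiable_is_diff[dV _].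
exact: (@differentiable_continuous R _ R^o _ _ dV).
Qed.

Lemma dotpvv_ge0 (R : realType) n (u : 'rV[R]_n) : 0 <= dotp u u.
Proof. by apply: sumr_ge0 => i _; rewrite -expr2 sqr_ge0. Qed.

Lemma dotpvv_eq0 (R : realType) n (u : 'rV[R]_n) : dotp u u = 0 -> u = 0.
Proof.
move/eqP; rewrite psumr_eq0 => [/allP u0|i _]; last by rewrite -expr2 sqr_ge0.
apply/rowP => i; rewrite mxE; apply/eqP.
by have := u0 i (mem_index_enum i); rewrite mulf_eq0 orbb.
Qed.

(** Carries the Euclidean error bound of the method over to the sup norm used in the Lipschitz
    estimates. *)
Lemma norm_le_enorm (R : realType) n (u : 'rV[R]_n) : `|u| <= enorm u.
Proof.
rewrite /Num.norm/= mx_normrE; apply/bigmax_leP; split; first exact: sqrtr_ge0.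
move=> [i j] _ /=; rewrite (ord1 i) -sqrtr_sqr ler_wsqrtr// expr2.
rewrite /dotp (bigD1 j)//= lerDl; apply: sumr_ge0 => k _.
by rewrite -expr2 sqr_ge0.
Qed.

(** * Uniform constants on compact sets *)

(** Local constants become one [L] by compactness. The point [y] may leave [K], as a numerical step
    may, and membership in [U] is part of the conclusion. *)
Lemma compact_uniform_lipschitz (R : realType) n (K U : set 'rV[R]_n)
    (V : 'rV[R]_n -> R) :
  compact K -> open U -> K `<=` U ->
  (forall a, U a -> strictly_differentiable V a (grad V a)) ->
  exists2 L : R, 0 < L & forall x y, K x -> `|y - x| < L^-1 ->
    U y /\ `|V y - V x| <= L * `|y - x|.
Proof.
move=> /compact_near_coveringP cK oU KU sdV.
pose P (L : R) x := forall y, `|y - x| < L^-1 ->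
    U y /\ `|V y - V x| <= L * `|y - x|.
have : \forall L \near +oo, K `<=` P L.
  apply: cK => a /KU Ua.
  have Lip := strictly_differentiable_lipschitz (sdV _ Ua).
  have /nbhs_ballP[r /= r0 rU] : nbhs a U by exact: open_nbhs_nbhs.
  have stay : \forall x \near a & L \near +oo, forall y, `|y - x| < L^-1 -> U y.
    near=> x L => /= y yx; apply: rU.
    rewrite -ball_normE/= distrC -(subrK x y) -addrA.
    apply: le_lt_trans (ler_normD _ _) _; rewrite [ltRHS]splitr ltrD//.
      have L0 : 0 < L by near: L; exact: nbhs_pinfty_gt.
      by apply: lt_le_trans yx _; rewrite invf_ple ?posrE ?divr_gt0.
    have : ball a (r / 2) x by near: x; apply: nbhsx_ballx; rewrite divr_gt0.
    by rewrite -ball_normE/= distrC.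
  apply: filterS (filterI Lip stay) => -[x L] [/= VL UL] y yx.
  by split; [exact: UL|exact: VL].
move=> KP.
have [L [L0 KL]] : exists L : R, 0 < L /\ K `<=` P L.
  near (+oo : set_system R) => L; exists L; split; near: L => //.
  exact: nbhs_pinfty_gt.
by exists L => // x y Kx; exact: KL.
Unshelve. all: end_near. Qed.

(** Near a point with [e <= V a], [g] stays above [g a / 2]; near a point with [V a < e] the
    condition is vacuous. Compactness then gives one [m]. *)
Lemma compact_uniform_lower_bound (R : realType) (T : topologicalType)
    (K : set T) (V g : T -> R) (e : R) :
  compact K -> (forall x, K x -> {for x, continuous V}) ->
  (forall x, K x -> {for x, continuous g}) ->
  (forall x, K x -> e <= V x -> 0 < g x) ->
  exists2 m : R, 0 < m & forall x, K x -> e <= V x -> m <= g x.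
Proof.
move=> /compact_near_coveringP cK cV cg g0.
pose P (m : R) x := e <= V x -> m <= g x.
have KP : \forall m \near 0^'+, K `<=` P m.
  apply: cK => a Ka; have [/(g0 _ Ka) ga|Va] := leP e (V a).
    near=> x m => _ /=; apply: (@le_trans _ _ (g a / 2)).
      by near: m; apply: nbhs_right_le; rewrite divr_gt0.
    near: x; apply: (@cvgr_ge _ _ (nbhs a) _ _ _ (cg _ Ka)).
    by rewrite ltr_pdivrMr// mulr_natr mulr2n ltrDl.
  near=> x m => /=; rewrite /P leNgt => /negP; case.
  by near: x; apply: (@cvgr_lt _ _ (nbhs a) _ _ _ (cV _ Ka)).
have [m [m0 Km]] : exists m : R, 0 < m /\ K `<=` P m.
  near (0 : R)^'+ => m; exists m; split; near: m => //; exact: nbhs_right_gt.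
by exists m => // x Kx; exact: Km.
Unshelve. all: end_near. Qed.

(** * Decay of [V] along exact solutions *)

Lemma is_derive_along_solution (R : realType) n (V : 'rV[R]_n -> R)
    (x : R -> 'rV[R]_n) (t : R) v :
  strictly_differentiable V (x t) (grad V (x t)) ->
  is_derive t (1 : R) x v ->
  is_derive t (1 : R) (V \o x) (dotp (grad V (x t)) v).
Proof.
move=> /strictly_differentiable_is_diff dV dx.
have dfx : differentiable x t by apply/derivable1_diffP; exact: ex_derive.
have dfV : differentiable V (x t) by exact: ex_diff.
have dfVx := differentiable_comp dfx dfV.
split; first exact: diff_derivable.
have dxE : 'd x t 1 = v by rewrite -deriveE//; exact: (@derive_val _ _ _ _ _ _ _ dx).
by rewrite deriveE// diff_comp//= dxE diff_val.
Qed.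

(** The mean value theorem for [V \o x]: by orthogonality of [grad V] and [f], only the term
    [- alpha |grad V|^2] survives in the derivative. At the endpoints continuity is enough, so
    [a = 0] and [b = T] are allowed. *)
Lemma dissipation (R : realType) n (U : set 'rV[R]_n) (V : 'rV[R]_n -> R)
    (f : 'rV[R]_n -> 'rV[R]_n) (alpha T : R) (x : R -> 'rV[R]_n) (a b : R) :
  (forall a, U a -> strictly_differentiable V a (grad V a)) ->
  (forall x, U x -> dotp (grad V x) (f x) = 0) ->
  solution_on (fun x => f x - alpha *: grad V x) U `[0, T] x ->
  0 <= a -> a < b -> b <= T ->
  exists2 c, c \in `]a, b[ &
    V (x b) - V (x a) = - (alpha * dotp (grad V (x c)) (grad V (x c))) * (b - a).
Proof.
move=> sdV A1 [cx xU dx] a0 ab bT.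
apply: (@MVT R (V \o x)
  (fun c => - (alpha * dotp (grad V (x c)) (grad V (x c))))) => //.
  move=> c cab.
  have cI : [set` `[0, T]]° c.
    rewrite interior_itv_bnd /= in_itv/=; move: cab; rewrite in_itv/= => /andP[ac cb].
    by rewrite (le_lt_trans a0 ac) (lt_le_trans cb bT).
  have Uc : U (x c) by apply: xU; exact: interior_subset cI.
  apply: is_derive_eq.
    by apply: is_derive_along_solution; [exact: sdV|exact: dx].
  by rewrite linearB linearZ/= A1// sub0r.
have abT : [set` `[a, b]] `<=` [set` `[0, T]].
  move=> c /=; rewrite !in_itv/= => /andP[ac cb].
  by rewrite (le_trans a0 ac) (le_trans cb bT).
apply: within_continuous_comp; last exact: continuous_subspaceW cx.
move=> _ /set_mem[c cab <-].
exact: strictly_differentiable_continuous (sdV _ (xU _ (abT _ cab))).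
Qed.

Lemma grad_sqnorm_continuous (R : realType) n (V : 'rV[R]_n -> R) (a : 'rV[R]_n) :
  (\forall b \near a, differentiable V b) ->
  strictly_differentiable V a (grad V a) ->
  {for a, continuous (fun x => dotp (grad V x) (grad V x))}.
Proof.
move=> dV sdV.
apply: (@cvg_big R _ +%R 0 xpredT (@add_continuous R) _ (nbhs a) _
  (fun i x => grad V x 0 i * grad V x 0 i)) => i _.
by apply: cvgM; exact: grad_continuous.
Qed.

(** * Choice of the step size and invariance of the sublevel set *)

Theorem theorem2 (R : realType) (n k l p : nat)
  (M U : set 'rV[R]_n)
  (f : 'rV[R]_n -> 'rV[R]_n) (fj : 'I_l -> 'rV[R]_n -> R) (xI : 'rV[R]_n)
  (V : 'rV[R]_n -> R) (nu alpha : R)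
  (dom : R -> set 'rV[R]_n) (Yh : R -> 'rV[R]_n -> 'rV[R]_n)
  (M_manifold : embedded_submanifold k M)
  (U_open : open U) (M_sub_U : M `<=` U)
  (f_smooth : smooth_on U f)
  (f_tangent : forall x, M x -> tangent_to M x (f x))
  (f_global : global_solutions_on f M)
  (xI_in_M : M xI)
  (fj_smooth : forall j, smooth_on U (fj j))
  (fj_integral : forall j, first_integral_on f M (fj j))
  (V_analytic : analytic_on U V)
  (V_ge0 : forall x, U x -> 0 <= V x)
  (V_zeros : [set x | U x /\ V x = 0] =
             [set x | [/\ U x, M x & forall j, fj j x = fj j xI]])
  (A1 : forall x, U x -> dotp (grad V x) (f x) = 0)
  (nu_gt0 : 0 < nu)
  (A2 : compact (sublevel U V nu))
  (A3 : forall x, sublevel U V nu x -> grad V x = 0 -> V x = 0)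
  (alpha_gt0 : 0 < alpha)
  (p_ge1 : (1 <= p)%N)
  (method : one_step_method p U (fun x => f x - alpha *: grad V x) dom Yh) :
  forall eps : R, 0 < eps < nu ->
    exists2 h0 : R, 0 < h0 &
      forall h : R, 0 < h < h0 ->
        positively_invariant (dom h) (step Yh h) (sublevel U V eps).
Proof.
move=> eps /andP[eps0 epsnu].
have sdV a : U a -> strictly_differentiable V a (grad V a).
  move=> Ua; have [v Vv] := analytic_strictly_differentiable V_analytic Ua.
  by rewrite -(strictly_differentiable_grad Vv).
have KU : sublevel U V nu `<=` U by move=> x [].
have [L L0 KL] := compact_uniform_lipschitz A2 U_open KU sdV.
(* By [A3] the gradient vanishes only where [V = 0], hence nowhere on the compact set where
   [eps / 2 <= V <= nu]. *)
have [m m0 Km] : exists2 m : R, 0 < m & forall x, sublevel U V nu x ->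
    eps / 2 <= V x -> m <= dotp (grad V x) (grad V x).
  apply: compact_uniform_lower_bound => //.
  - by move=> x /KU Ux; exact: strictly_differentiable_continuous (sdV _ Ux).
  - move=> x /KU Ux; apply: grad_sqnorm_continuous; last exact: sdV.
    near=> b; have Ub : U b by near: b; exact: open_nbhs_nbhs.
    by case: (strictly_differentiable_is_diff (sdV _ Ub)).
  - move=> x Kx Vx; rewrite lt_neqAle dotpvv_ge0 andbT; apply/eqP => /esym.
    move=> /dotpvv_eq0 /(A3 _ Kx) V0.
    by move: Vx; rewrite V0 leNgt divr_gt0.
have [hloc [C [hloc0 C0 Kstep]]] := method _ A2 KU.
have LC0 : 0 < L * C by rewrite mulr_gt0.
(* Below [hloc] the error bound holds; below 1, [h ^ p.+1 <= h ^ 2]; below [(L * C)^-1] the error is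
   less than [L^-1], the range of the Lipschitz bound. The last two entries make [L * C * h] smaller
   than [eps / 2] and than [alpha * m]. *)
pose h0 := Num.min hloc (Num.min 1
  (Num.min (L * C)^-1 (Num.min (eps / 2 / (L * C)) (alpha * m / (L * C))))).
exists h0; first by rewrite !lt_min hloc0 ltr01 invr_gt0 LC0 !divr_gt0// mulr_gt0.
move=> h /andP[h_gt0]; rewrite !lt_min => /and5P[h_loc h_1 h_L h_eps h_m].
move=> xi [Uxi]; rewrite /= in_itv/= => /andP[_ Vxi].
have Kxi : sublevel U V nu xi.
  by split => //=; rewrite in_itv/= V_ge0// (le_trans Vxi) ?ltW.
have [x [sol x0 err]] := Kstep _ Kxi.
have [|dom_xi {}err] := err h; first by rewrite h_gt0 ltW.
split => //.
have decr a b : 0 <= a -> a < b -> b <= hloc -> V (x b) <= V (x a).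
  move=> a0 ab bh; have [c _ Vab] := dissipation sdV A1 sol a0 ab bh.
  rewrite -subr_le0 Vab mulNr oppr_le0.
  by rewrite !mulr_ge0 ?dotpvv_ge0 ?subr_ge0 ?ltW.
have Ux t : 0 <= t -> t <= hloc -> U (x t).
  by move=> t0 th; case: sol => _ + _; apply; rewrite /= in_itv/= t0.
have Vx_eps t : 0 < t -> t <= hloc -> V (x t) <= eps.
  by move=> t0 th; rewrite (le_trans (decr 0 t _ _ _))// x0.
have Kx t : 0 < t -> t <= hloc -> sublevel U V nu (x t).
  move=> t0 th; split; first exact: Ux (ltW t0) th.
  rewrite /= in_itv/= V_ge0/=; last exact: Ux (ltW t0) th.
  exact: le_trans (Vx_eps _ t0 th) (ltW epsnu).
have dist : `|step Yh h xi - x h| <= C * h ^+ 2.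
  apply: le_trans (norm_le_enorm _) _; apply: le_trans err _.
  by rewrite ler_pM2l// ler_wiXn2l// ltW.
have near_x : `|step Yh h xi - x h| < L^-1.
  apply: le_lt_trans dist _; apply: (@lt_trans _ _ (C * h)).
    by rewrite ltr_pM2l// expr2 gtr_pMr.
  by move: h_L; rewrite invfM -ltr_pdivrMr ?invr_gt0// invrK mulrC.
have [Ustep Vstep] := KL _ _ (Kx h h_gt0 (ltW h_loc)) near_x.
split => //; rewrite /= in_itv/= V_ge0//=.
have {}Vstep : V (step Yh h xi) <= V (x h) + L * C * h * h.
  rewrite -lerBlDl; apply: le_trans (ler_norm _) _; apply: le_trans Vstep _.
  by rewrite -!mulrA ler_pM2l// -expr2.
apply: le_trans Vstep _.
have [c] := dissipation sdV A1 sol (lexx 0) h_gt0 (ltW h_loc).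
rewrite in_itv/= => /andP[c0 ch] Vxh.
have c_hloc : c <= hloc by rewrite ltW// (lt_trans ch).
move: h_eps h_m; rewrite !ltr_pdivlMr// => h_eps h_m.
(* The case split is made at the mean value time [c]. If [V (x c)] is at least [eps / 2], the
   decrease over the step is at least [alpha * m * h], which outweighs the error [L * C * h * h].
   Otherwise [V (x h) <= V (x c) < eps / 2] by monotonicity, and the error is below the other
   [eps / 2]. *)
have [Vc|Vc] := leP (eps / 2) (V (x c)).
  have gm := Km _ (Kx c c0 c_hloc) Vc.
  have : alpha * m * h <= alpha * dotp (grad V (x c)) (grad V (x c)) * h.
    by rewrite ler_pM2r// ler_pM2l.
  have : L * C * h * h <= alpha * m * h by rewrite ler_pM2r// mulrC ltW.
  move: Vxh; rewrite x0 subr0 mulNr; lra.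
have := decr _ _ (ltW c0) ch (ltW h_loc).
have : L * C * h * h <= L * C * h by rewrite ger_pMr ?ltW// mulr_gt0.
lra.
Unshelve. all: end_near. Qed.
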